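(* Let $n\ge 2$, and let $(N,v)$ be the simple MCST-saving game defined by a 0-1 weighted complete graph $\langle K[N_r],\widetilde w\rangle$, where $N=\{1,\dots,n\}$ and $N_r=N\cup\{r\}$. Let $\phi$ denote the Shapley value of $(N,v)$. For any player $i\in N$, the following statements are equivalent: (0) $\phi_i\neq 0$; (1) player $i$ is not a null player; (2) there exists $j\in N\setminus\{i\}$ such that $(\widetilde w(r,i),\widetilde w(i,j),\widetilde w(r,j))\in\{(1,0,0),(1,0,1),(0,0,1)\}$; (3) $\displaystyle \phi_i\ge \frac{1}{n(n-1)}$.
   Context: Let $N=\{1,\dots,n\}$ be a set of players, $r\notin N$ a distinguished node (the root), and $N_r=N\cup\{r\}$. $K[V]$ denotes the undirected complete graph on vertex set $V$. A 0-1 weighted complete graph $\langle K[N_r],\widetilde w\rangle$ consists of $K[N_r]$ together with a weight $\widetilde w(i,j)=\widetilde w(j,i)\in\{0,1\}$ for each edge $\{i,j\}$. For non-empty $S\subseteq N$, $c(S)$ is the minimum of $\sum_{e\in T}\widetilde w(e)$ over all spanning trees $T$ (identified with their edge sets) of $K[S\cup\{r\}]$, and $c(\emptyset)=0$. The pair $(N,c)$ is the simple MCST (minimum cost spanning tree) game. The associated simple MCST-saving game $(N,v)$ is defined by $v(S)=\sum_{i\in S}c(\{i\})-c(S)=\sum_{i\in S}\widetilde w(r,i)-c(S)$, $v(\emptyset)=0$. Player $i$ is a null player of $(N,v)$ if $v(S\cup\{i\})=v(S)$ for all $S\subseteq N\setminus\{i\}$. A permutation of $N$ is a bijection $\pi:\{1,\dots,n\}\to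 N$; $\Pi_N$ is the set of all of them. $\mathrm{Prc}(\pi,i)$ is the set of players preceding $i$ in $\pi$. The Shapley value of $(N,v)$ is $\phi_i=\frac{1}{n!}\sum_{\pi\in\Pi_N}\bigl(v(\mathrm{Prc}(\pi,i)\cup\{i\})-v(\mathrm{Prc}(\pi,i))\bigr)$ for $i\in N$. *)

(* Defs.v *)
From mathcomp Require Import all_boot all_order all_algebra all_fingroup.

Set Implicit Arguments.
Unset Strict Implicit.
Unset Printing Implicit Defensive.

Import Order.TTheory GRing.Theory Num.Theory.

Section Trees.

Variable V : finType.
Implicit Types (U : {set V}) (T : {set {set V}}).

(* A graph on V is given by its set of edges, an edge being a two-element
   set of vertices. *)

Definition complete_edges U : {set {set V}} :=
  [set e : {set V} | (e \subset U) && (#|e| == 2)].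

Definition adj T : rel V := fun x y => (x != y) && ([set x; y] \in T).

Definition connected_on U T : bool :=
  [forall x in U, forall y in U, connect (adj T) x y].

(* Bounding the length of a simple cycle by #|V| loses nothing and makes the
   predicate boolean; see acyclicP. *)
Definition acyclic T : bool :=
  [forall k : 'I_#|V|.+1, forall p : k.-tuple V,
     (2 < k) ==> ~~ ucycleb (adj T) p].

Lemma acyclicP T :
  reflect (forall p : seq V, 2 < size p -> ~~ ucycleb (adj T) p) (acyclic T).
Proof.
apply: (iffP idP) => [acT p p_gt2 | acT].
  apply/negP => /[dup] cp /andP[_ Up].
  have szp : size p < #|V|.+1 by rewrite ltnS -(card_uniqP Up) max_card.
  have /forallP/(_ (in_tuple p)) := forallP acT (Ordinal szp).
  by rewrite /= p_gt2 cp.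
apply/forallP => k; apply/forallP => p; apply/implyP => k_gt2.
by apply: acT; rewrite size_tuple.
Qed.

Definition spanning_tree U T : bool :=
  [&& T \subset complete_edges U, connected_on U T & acyclic T].

Definition tree_cost (w : {set V} -> nat) T : nat := \sum_(e in T) w e.

End Trees.

Section SimpleMCST.

Variable n : nat.
Implicit Types (S : {set 'I_n}) (i j : 'I_n) (w : {set option 'I_n} -> nat).

(* The players are 'I_n, and option 'I_n adjoins the root to them. *)
Definition rnode : option 'I_n := None.

Definition rooted S : {set option 'I_n} := rnode |: [set Some i | i in S].

(* The weight of the edge {x, y} is w [set x; y]; the values of w at sets that
   do not have exactly two elements are never used. *)
Definition zero_one_weights w : Prop :=
  forall x y : option 'I_n, x != y -> w [set x; y] \in [:: 0; 1].

Definition star S : {set {set option 'I_n}} :=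
  [set [set rnode; Some i] | i in S].

(* [arg min] needs a default element, here the star centred at the root; it
   is a spanning tree by star_spanning_tree. *)
Definition mcst_cost w S : nat :=
  if S == set0 then 0 else
  tree_cost w
    [arg min_(T < star S | spanning_tree (rooted S) T) tree_cost w T].

Lemma adj_star S x y :
  adj (star S) x y -> (x == rnode) (+) (y == rnode).
Proof.
case/andP => neq_xy /imsetP[i _ exy].
have xi : x \in [set rnode; Some i] by rewrite -exy set21.
have yi : y \in [set rnode; Some i] by rewrite -exy set22.
move: xi yi neq_xy; rewrite !inE.
by case/orP=> /eqP-> ; case/orP=> /eqP->; rewrite ?eqxx.
Qed.

Lemma star_spanning_tree S : spanning_tree (rooted S) (star S).
Proof.
apply/and3P; split.
- apply/subsetP => _ /imsetP[i iS ->]; rewrite inE cards2 /= andbT.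
  apply/subsetP => x; rewrite !inE => /orP[] /eqP-> //.
  by rewrite imset_f ?orbT.
- have toS x : x \in rooted S ->
      connect (adj (star S)) x rnode && connect (adj (star S)) rnode x.
    rewrite !inE => /orP[/eqP-> | /imsetP[i iS ->]]; first by rewrite connect0.
    have e : [set rnode; Some i] \in star S by apply: imset_f.
    by rewrite !connect1 // /adj /= ?e // setUC e.
  apply/forall_inP => x /toS/andP[xr _]; apply/forall_inP => y /toS/andP[_ ry].
  exact: connect_trans xr ry.
apply/acyclicP => -[|x [|y [|z p]]] // _; apply/negP.
case/andP=> /= /and3P[/adj_star xy /adj_star yz zp].
rewrite !inE !negb_or => /andP[/and3P[_ nxz _]] /andP[/andP[_ yp] _].
have [y0 | y0] := eqVneq y rnode; last first.
  move: xy yz nxz; rewrite (negPf y0) addbF addFb => /eqP-> /eqP->.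
  by rewrite eqxx.
move: xy yz; rewrite y0 eqxx addbT addTb => /negPf x0 /negPf z0.
case: p zp yp => [|u p] /= /andP[/adj_star]; rewrite z0 ?x0 //= => /eqP-> _.
by rewrite inE y0 eqxx.
Qed.

Lemma mcst_cost_min w S : S != set0 ->
  (exists2 T, spanning_tree (rooted S) T & mcst_cost w S = tree_cost w T) /\
  (forall T, spanning_tree (rooted S) T -> mcst_cost w S <= tree_cost w T).
Proof.
move=> /negPf S0; rewrite /mcst_cost S0.
case: arg_minnP => [|T stT minT]; first exact: star_spanning_tree.
by split; first exists T.
Qed.

End SimpleMCST.

Section Games.

Local Open Scope ring_scope.

Variables (R : realFieldType) (n : nat).
Implicit Types (v : {set 'I_n} -> R) (i : 'I_n).

Definition mcst_saving (w : {set option 'I_n} -> nat) (S : {set 'I_n}) : R :=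
  \sum_(i in S) (mcst_cost w [set i])%:R - (mcst_cost w S)%:R.

Definition null_player v i : Prop :=
  forall S : {set 'I_n}, S \subset ~: [set i] -> v (i |: S) = v S.

(* s k is the player in position k of the order s. *)
Definition prc (s : {perm 'I_n}) i : {set 'I_n} :=
  [set s k | k : 'I_n & (k < (s^-1)%g i)%N].

Definition shapley v i : R :=
  (n`!)%:R^-1 * \sum_(s : {perm 'I_n}) (v (i |: prc s i) - v (prc s i)).

End Games.

(* Main.v *)
Require Import Defs.
From mathcomp Require Import all_boot all_order all_algebra all_fingroup.

Import Order.TTheory GRing.Theory Num.Theory.

(** The cost c(S) is also the least cost of a connected graph on S + r, because
    a minimal connected graph is a tree; so cost bounds only need connected
    graphs.  Hanging i on the root shows that marginal contributions to v are
    nonnegative.  Contracting i onto another node p turns a tree on S + i + r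
    into a connected graph on S + r: if no j is as in (2), then either all
    edges at i have weight 1 and p is a neighbour of i in the tree, or
    w(r, i) = 0 and p = r, and both times the contraction saves w(r, i), so
    that i is a null player.  If j is as in (2), then i contributes at least 1
    to every order starting with j, i, and these are (n - 2)! of the n!
    orders. *)

Set Implicit Arguments.
Unset Strict Implicit.
Unset Printing Implicit Defensive.

(** * Connected graphs: deleting a cycle edge, adding a leaf, contracting a vertex *)

Section ConnectedGraphs.

Variable V : finType.
Implicit Types (U : {set V}) (T : {set {set V}}) (w : {set V} -> nat).

Lemma adj_sym T : symmetric (adj T).
Proof. by move=> x y; rewrite /adj eq_sym setUC. Qed.

Lemma connect_adj_sym T : connect_sym (adj T).
Proof. exact/sym_connect_sym/adj_sym. Qed.

Lemma connected_onP U T :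
  reflect {in U &, forall x y, connect (adj T) x y} (connected_on U T).
Proof.
apply: (iffP forall_inP) => [cT x y xU yU | cT x xU].
  exact: (forall_inP (cT x xU)).
by apply/forall_inP => y yU; apply: cT.
Qed.

(** Edges need only go to connected pairs, so [f] may collapse an edge to a point or replace it by a
    detour. *)
Lemma connect_homo (W : finType) (e : rel V) (e' : rel W) (f : V -> W) :
  (forall x y, e x y -> connect e' (f x) (f y)) ->
  forall x y, connect e x y -> connect e' (f x) (f y).
Proof.
move=> he x y /connectP[p]; elim: p x => [|z p IHp] x /=.
  by move=> _ ->; apply: connect0.
by case/andP=> /he xz /IHp zy /zy; apply: connect_trans.
Qed.

Lemma connect_adj_sub T1 T2 x y :
  T1 \subset T2 -> connect (adj T1) x y -> connect (adj T2) x y.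
Proof.
move=> /subsetP sT; apply: (connect_homo (f := id)) => a b /andP[nab Tab].
by apply: connect1; rewrite /adj nab sT.
Qed.

(** The rest of the cycle, from [y] through [z :: q] back to [x], is a detour around the deleted
    edge. *)
Lemma connect_del_cycle_edge T x y z q :
  ucycle (adj T) [:: x, y, z & q] ->
  forall a b, connect (adj T) a b -> connect (adj (T :\ [set x; y])) a b.
Proof.
case/andP=> /= /and3P[_ yz zq]; rewrite !inE !negb_or.
move=> /and4P[/and3P[nxy nxz xq] /andP[nyz yq] nzq uq].
pose e' := adj (T :\ [set x; y]).
have off_x : {in predC1 x &, subrel (adj T) e'}.
  move=> a b /= nax nbx /andP[nab Tab]; rewrite /e' /adj nab !inE Tab andbT /=.
  apply: contraTneq (set21 x y) => <-.
  by rewrite !inE ![x == _]eq_sym negb_or; apply/andP; split.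
have cyx : connect e' y x.
  move: zq; rewrite rcons_path => /andP[zq /andP[nlx Tlx]].
  have ayzq : all (predC1 x) [:: y, z & q].
    rewrite /= ![_ == x]eq_sym nxy nxz /=; apply/allP => u uq' /=.
    by apply: contraNneq xq => <-.
  have cyl : connect e' y (last z q).
    apply/connectP; exists (z :: q) => //.
    by apply: (sub_in_path off_x ayzq); rewrite /= yz.
  apply: connect_trans cyl _; apply: connect1.
  (* The closing edge joins [last z q] to [x]. If it were the deleted edge, [y] would occur twice in
     the cycle. *)
  rewrite /e' /adj nlx !inE Tlx andbT /=; apply/eqP => /setP/(_ y).
  rewrite !inE eqxx orbT [y == x]eq_sym (negPf nxy) orbF => /eqP yl.
  have : y \in z :: q by rewrite yl mem_last.
  by rewrite inE (negPf nyz) (negPf yq).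
apply: (connect_homo (f := id)) => a b /andP[nab Tab].
have [eab | neab] := eqVneq [set a; b] [set x; y]; last first.
  by apply: connect1; rewrite /adj nab !inE neab.
have : a \in [set x; y] by rewrite -eab set21.
have : b \in [set x; y] by rewrite -eab set22.
rewrite !inE => /orP[]/eqP eb /orP[]/eqP ea; subst; rewrite ?eqxx // in nab *.
by rewrite connect_adj_sym.
Qed.

Lemma connected_has_spanning_tree U T :
  T \subset complete_edges U -> connected_on U T ->
  exists2 T', spanning_tree U T' & T' \subset T.
Proof.
move=> sTU cT; have [T' /minsetP[cT' minT'] sT'] := minset_exists cT.
exists T' => //; rewrite /spanning_tree (subset_trans sT') // cT' /=.
apply/acyclicP => -[|x [|y [|z q]]] // _; apply/negP => cyc.
have /andP[/= /andP[/andP[_ xyT'] _] _] := cyc.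
suff /minT' : connected_on U (T' :\ [set x; y]).
  by move=> /(_ (subD1set _ _))/setP/(_ [set x; y]); rewrite !inE eqxx xyT'.
apply/connected_onP => a b aU bU; apply: connect_del_cycle_edge cyc _ _ _.
exact: (connected_onP _ _ cT').
Qed.

Lemma tree_cost_sub w T1 T2 :
  T1 \subset T2 -> tree_cost w T1 <= tree_cost w T2.
Proof.
move=> /setIidPl <-; rewrite /tree_cost [leqRHS](bigID (mem T1)) /=.
rewrite (eq_bigl _ _ (fun e => in_setI e T1 T2)).
by rewrite (eq_bigl _ _ (fun e => andbC _ _)) leq_addr.
Qed.

(** Needed because contraction can merge two edges into one, whose weight is then counted once. *)
Lemma leq_sum_imset (I J : finType) (f : I -> J) (A : {set I}) (F : J -> nat) :
  \sum_(y in f @: A) F y <= \sum_(x in A) F (f x).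
Proof.
rewrite [leqRHS](partition_big_imset f) leq_sum // => y /imsetP[x xA ->].
by rewrite (bigD1 x) ?xA ?eqxx //= leq_addr.
Qed.

Lemma connected_on_add_edge U T a p :
  p \in U -> a \notin U -> connected_on U T ->
  connected_on (a |: U) ([set a; p] |: T).
Proof.
move=> pU aU /connected_onP cT; set T' := _ |: T.
have cap : connect (adj T') a p.
  apply: connect1; rewrite /adj !inE eqxx andbT.
  by apply: contraNneq aU => ->.
have to_p x : x \in a |: U -> connect (adj T') x p.
  case/setU1P=> [-> // | xU].
  by apply: connect_adj_sub (cT x p xU pU); apply: subsetUr.
apply/connected_onP => x y /to_p xp /to_p yp; apply: connect_trans xp _.
by rewrite connect_adj_sym.
Qed.

(** The cardinality test discards the edges that [f] collapses to a single vertex; parallel images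
    merge by themselves, edges being sets. *)
Definition image_graph (f : V -> V) T : {set {set V}} :=
  [set f @: (e : {set V}) | e in [set e in T | #|f @: (e : {set V})| == 2]].

Lemma imset_set2 (f : V -> V) x y : f @: [set x; y] = [set f x; f y].
Proof. by rewrite imsetU1 imset_set1. Qed.

Lemma connected_on_image f U T :
  connected_on U T -> connected_on (f @: U) (image_graph f T).
Proof.
move/connected_onP=> cT.
apply/connected_onP => _ _ /imsetP[x xU ->] /imsetP[y yU ->].
apply: connect_homo (cT x y xU yU) => a b /andP[nab Tab].
have [-> | nfab] := eqVneq (f a) (f b); first exact: connect0.
apply: connect1; rewrite /adj nfab /= -imset_set2; apply: imset_f.
by rewrite inE Tab imset_set2 cards2 nfab.
Qed.

Lemma image_graph_complete f U T :
  T \subset complete_edges U -> image_graph f T \subset complete_edges (f @: U).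
Proof.
move=> /subsetP sT; apply/subsetP => _ /imsetP[e + ->]; rewrite !inE.
by case/andP=> /sT; rewrite inE => /andP[eU _] ->; rewrite imsetS.
Qed.

Definition contract (a p x : V) := if x == a then p else x.

Lemma contract_imset a p U :
  p \in U -> a \notin U -> contract a p @: (a |: U) = U.
Proof.
move=> pU aU; rewrite imsetU1 /contract eqxx.
have -> : [set contract a p x | x in U] = U.
  rewrite -[RHS]imset_id; apply: eq_in_imset => x xU.
  by rewrite /contract ifN //; apply: contraNneq aU => <-.
by apply/setUidPr; rewrite sub1set.
Qed.

(** Edges away from [a] are unchanged, an edge from [a] to [u] becomes the no dearer edge from [p]
    to [u], and the edge from [a] to [p] disappears, which saves its whole weight. *)
Lemma contract_cost w a p U T :
    T \subset complete_edges (a |: U) -> a \notin U ->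
    {in U, forall u, u != p -> w [set p; u] <= w [set a; u]} ->
  tree_cost w (image_graph (contract a p) T)
    + (if [set a; p] \in T then w [set a; p] else 0) <= tree_cost w T.
Proof.
move=> /subsetP sT aU w_le; set f := contract a p.
have w_im e : e \in T -> #|f @: e| == 2 -> w (f @: e) <= w e.
  move=> /sT; rewrite inE => /andP[sU /cards2P[x [y [nxy ee]]]].
  have from_a u : u \in a |: U -> u != a -> #|f @: [set a; u]| == 2 ->
      w (f @: [set a; u]) <= w [set a; u].
    case/setU1P=> [-> | uU nua]; first by rewrite eqxx.
    rewrite imset_set2 /f /contract eqxx (negPf nua) cards2.
    by case: (eqVneq u p) => // nup _; exact: w_le.
  have [xU yU] : x \in a |: U /\ y \in a |: U.
    by move: sU; rewrite ee subUset !sub1set => /andP.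
  rewrite {}ee; have [ex | nxa] := eqVneq x a.
    by rewrite ex; apply: from_a; rewrite // -ex eq_sym.
  have [ey | nya] := eqVneq y a; first by rewrite ey setUC; apply: from_a.
  by rewrite imset_set2 /f /contract (negPf nxa) (negPf nya).
have cost_le : tree_cost w (image_graph f T)
    <= \sum_(e in T | #|f @: e| == 2) w e.
  apply: leq_trans (leq_sum_imset _ _ _) _.
  rewrite (eq_bigl _ _ (fun e => in_set _ e)).
  by apply: leq_sum => e /andP[]; apply: w_im.
apply: leq_trans (leq_add cost_le (leqnn _)) _.
(* Split the edges of [T] into surviving and collapsed ones; the edge from [a] to [p] is among the
   latter. *)
rewrite /tree_cost [leqRHS](bigID (fun e : {set V} => #|f @: e| == 2)) /= leq_add2l.
case: ifP => // apT; rewrite (bigD1 [set a; p]) ?leq_addr //= apT.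
by rewrite imset_set2 cards2 /f /contract eqxx if_same eqxx.
Qed.

End ConnectedGraphs.

(** * Bounds on the cost when a player joins or leaves *)

Section Costs.

Variables (n : nat) (w : {set option 'I_n} -> nat).
Implicit Types (S : {set 'I_n}) (i j : 'I_n) (T : {set {set option 'I_n}}).

Local Notation r := (rnode n).
Local Notation c := (mcst_cost w).

Lemma rooted0 : rooted set0 = [set r].
Proof. by rewrite /rooted imset0 setU0. Qed.

Lemma rootedU1 i S : rooted (i |: S) = Some i |: rooted S.
Proof. by rewrite /rooted imsetU1 setUCA. Qed.

Lemma mem_rooted i S : (Some i \in rooted S) = (i \in S).
Proof. by rewrite !inE mem_imset //; apply: Some_inj. Qed.

Lemma rnode_rooted S : r \in rooted S.
Proof. exact: setU11. Qed.

(** For empty [S] the witness is the edgeless graph on the root, so that later arguments treat all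
    coalitions alike. *)
Lemma mcst_cost_witness S :
  exists T, [/\ T \subset complete_edges (rooted S), connected_on (rooted S) T
              & tree_cost w T = c S].
Proof.
have [-> | S0] := eqVneq S set0.
  exists set0; rewrite sub0set /mcst_cost eqxx /tree_cost big_set0; split=> //.
  apply/connected_onP => x y; rewrite rooted0 => /set1P-> /set1P->.
  exact: connect0.
have [[T /and3P[sT cT _] eT] _] := mcst_cost_min w S0.
by exists T.
Qed.

Lemma mcst_cost_le S T :
  T \subset complete_edges (rooted S) -> connected_on (rooted S) T ->
  c S <= tree_cost w T.
Proof.
move=> sT cT; have [-> | S0] := eqVneq S set0; first by rewrite /mcst_cost eqxx.
have [T' stT' sT'] := connected_has_spanning_tree sT cT.
by apply: leq_trans (tree_cost_sub w sT'); apply: (mcst_cost_min w S0).2.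
Qed.

Lemma mcst_cost_add S i p :
  i \notin S -> p \in rooted S -> c (i |: S) <= w [set Some i; p] + c S.
Proof.
move=> iS pS; have iU : Some i \notin rooted S by rewrite mem_rooted.
have [T [sT cT <-]] := mcst_cost_witness S.
have nTip : [set Some i; p] \notin T.
  apply: contra iU => /(subsetP sT); rewrite inE => /andP[/subsetP sU _].
  by apply: sU; rewrite set21.
have -> : w [set Some i; p] + tree_cost w T = tree_cost w ([set Some i; p] |: T).
  by rewrite /tree_cost big_setU1.
apply: mcst_cost_le; rewrite rootedU1; last exact: connected_on_add_edge.
rewrite subUset sub1set; apply/andP; split.
  rewrite inE subUset !sub1set setU11 (setU1r _ pS) cards2.
  by rewrite (_ : Some i != p) //; apply: contraNneq iU => ->.
apply: subset_trans sT _; apply/subsetP => e; rewrite !inE => /andP[eS ->].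
by rewrite (subset_trans eS) ?subsetUr.
Qed.

Lemma mcst_cost_contract S i p T :
    i \notin S -> p \in rooted S ->
    T \subset complete_edges (rooted (i |: S)) ->
    connected_on (rooted (i |: S)) T ->
    {in rooted S, forall u, u != p -> w [set p; u] <= w [set Some i; u]} ->
  c S + (if [set Some i; p] \in T then w [set Some i; p] else 0)
    <= tree_cost w T.
Proof.
move=> iS pS; rewrite -(mem_rooted i) in iS; rewrite rootedU1 => sT cT w_le.
apply: leq_trans (contract_cost sT iS w_le); rewrite leq_add2r.
have := connected_on_image (contract (Some i) p) cT.
have := image_graph_complete (contract (Some i) p) sT.
by rewrite contract_imset //; apply: mcst_cost_le.
Qed.

(** Here [p] is a neighbour of [i] in an optimal graph. It is not known beforehand, hence the weight
    condition for all [p]. *)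
Lemma mcst_cost_del S i :
    i \notin S ->
    {in rooted S &, forall p u, u != p -> w [set p; u] <= w [set Some i; u]} ->
  exists2 p, p \in rooted S & c S + w [set Some i; p] <= c (i |: S).
Proof.
move=> iS w_le; have [T [sT cT <-]] := mcst_cost_witness (i |: S).
(* The first step of a path from [i] to the root gives the neighbour [p]. *)
have /connectP[[|p q] //=] : connect (adj T) (Some i) r.
  by apply: (connected_onP _ _ cT); rewrite ?rnode_rooted ?mem_rooted ?setU11.
case/andP=> /andP[nip Tip] _ _.
have pS : p \in rooted S.
  move: Tip => /(subsetP sT); rewrite inE rootedU1 => /andP[/subsetP sU _].
  by case/setU1P: (sU p (set22 _ _)) nip => // ->; rewrite eqxx.
exists p => //; have := mcst_cost_contract iS pS sT cT; rewrite Tip; apply.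
by move=> u uS; apply: w_le.
Qed.

(** Both bounds are the case of empty [S], where the root is the only candidate for [p] and the
    weight condition is vacuous. *)
Lemma mcst_cost1 i : c [set i] = w [set r; Some i].
Proof.
have c0 : c set0 = 0 by rewrite /mcst_cost eqxx.
have i0 : i \notin set0 by rewrite inE.
apply/eqP; rewrite eqn_leq -(setU0 [set i]); apply/andP; split.
  have := mcst_cost_add i0 (rnode_rooted set0).
  by rewrite c0 addn0 (setUC [set r]).
have [p u|p] := mcst_cost_del i0.
  by rewrite rooted0 => /set1P-> /set1P->; rewrite eqxx.
by rewrite rooted0 c0 => /set1P->; rewrite (setUC [set r]).
Qed.

End Costs.

(** Fix one order [s0] starting with [j], [i]. Precomposing it with the permutations of positions
    that fix the first two gives distinct orders with the same start. *)
Lemma card_perm_prc1 (n : nat) (i j : 'I_n) : (2 <= n)%N -> j != i ->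
  ((n - 2)`! <= #|[set s : {perm 'I_n} | prc s i == [set j]]|)%N.
Proof.
move=> n2 nji; pose k0 := Ordinal (ltnW n2); pose k1 := Ordinal n2.
(* The first transposition puts [j] in position 0. The second brings [i] to position 1 and leaves
   [j] alone, as [j] differs from both [t k1] and [i]. *)
pose t := tperm k0 j; pose s0 := (t * tperm (t k1) i)%g.
have s00 : s0 k0 = j.
  rewrite permM tpermL tpermD // 1?eq_sym //.
  by rewrite -[j in j != _](tpermL k0) (inj_eq perm_inj).
have s01 : s0 k1 = i by rewrite permM tpermL.
have <- : #|[set u : {perm 'I_n} | perm_on (~: [set k0; k1]) u]| = (n - 2)`!%N.
  rewrite cardsE card_perm; congr (_ `!); have := cardsC [set k0; k1].
  rewrite cards2 card_ord => cardC2.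
  by apply/eqP; rewrite -(eqn_add2l 2) cardC2 subnKC.
rewrite -(card_imset _ (mulIg s0)); apply/subset_leq_card/subsetP.
move=> _ /imsetP[u + ->]; rewrite !inE => u_on; set s := (u * s0)%g.
have [s_0 s_1] : s k0 = j /\ s k1 = i.
  by rewrite ![s _]permM !(out_perm u_on) ?inE ?eqxx ?orbT.
apply/eqP/setP => x; rewrite /prc -s_1 permK inE -s_0.
apply/imsetP/eqP => [[k] | ->]; last by exists k0; rewrite ?inE.
by rewrite inE ltnS leqn0 => /eqP k_0 ->; congr (s _); apply: val_inj.
Qed.

(** * Marginal contributions in the saving game and the Shapley value *)

Section Savings.

Local Open Scope ring_scope.

Variables (R : realFieldType) (n : nat).
Implicit Types (S : {set 'I_n}) (i j : 'I_n).

Lemma null_player_shapley (v : {set 'I_n} -> R) i :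
  null_player v i -> shapley v i = 0.
Proof.
move=> null; rewrite /shapley big1 ?mulr0 // => s _; rewrite null ?subrr //.
apply/subsetP => _ /imsetP[k + ->]; rewrite !inE => k_lt.
by apply: contraTneq k_lt => <-; rewrite permK ltnn.
Qed.

(** The orders in which exactly [j] precedes [i] contribute at least 1 each, all others at least 0,
    and n! = n (n - 1) (n - 2)!. *)
Lemma shapley_ge (v : {set 'I_n} -> R) i j :
    (2 <= n)%N -> j != i -> (forall S, 0 <= v (i |: S) - v S) ->
    1 <= v [set i; j] - v [set j] ->
  1 / (n%:R * (n%:R - 1)) <= shapley v i.
Proof.
move=> n2 nji v_mono v_ij; rewrite /shapley.
have facE : n`!%:R = n%:R * (n%:R - 1) * (n - 2)`!%:R :> R.
  case: n n2 {i j v nji v_mono v_ij} => [|[|m]] // _.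
  by rewrite !factS subn2 /= !natrM mulrA -[X in _ - X]/(1%:R) -natrB.
have fac_neq0 m : m`!%:R != 0 :> R by rewrite pnatr_eq0 -lt0n fact_gt0.
have -> : 1 / (n%:R * (n%:R - 1)) = n`!%:R^-1 * (n - 2)`!%:R :> R.
  by rewrite facE [X in _ = X * _]invfM mulfVK // div1r.
rewrite ler_wpM2l ?invr_ge0 ?ler0n //.
set A := [set s : {perm 'I_n} | prc s i == [set j]].
rewrite (bigID (mem A)) /=.
apply: le_trans (_ : \sum_(s in A) 1 <= _).
  by rewrite sumr_const ler_nat card_perm_prc1.
rewrite -[leLHS]addr0 lerD ?sumr_ge0 //.
by apply: ler_sum => s; rewrite inE => /eqP->.
Qed.

Variable w : {set option 'I_n} -> nat.

Local Notation v := (mcst_saving R w).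
Local Notation r := (rnode n).

Lemma mcst_saving_marginal S i : i \notin S ->
  v (i |: S) - v S
  = (w [set r; Some i] + mcst_cost w S)%:R - (mcst_cost w (i |: S))%:R.
Proof.
move=> iS; rewrite /mcst_saving big_setU1 //= mcst_cost1 natrD.
by rewrite opprB addrAC addrACA subrr addr0.
Qed.

Lemma mcst_saving_mono S i : 0 <= v (i |: S) - v S.
Proof.
have [iS | iS] := boolP (i \in S).
  by rewrite (setUidPr _) ?subrr // sub1set.
rewrite mcst_saving_marginal // subr_ge0 ler_nat.
by have := mcst_cost_add w iS (rnode_rooted S); rewrite (setUC [set r]).
Qed.

Lemma mcst_saving_null i :
    (forall S, i \notin S ->
       (mcst_cost w S + w [set r; Some i] <= mcst_cost w (i |: S))%N) ->
  null_player v i.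
Proof.
move=> c_ge S; rewrite subsetC sub1set inE => iS.
apply/eqP; rewrite -subr_eq0 eq_le mcst_saving_mono andbT.
by rewrite mcst_saving_marginal // subr_le0 ler_nat addnC c_ge.
Qed.

Lemma mcst_saving_pair i j : j != i ->
    (w [set r; Some i], w [set Some i; Some j], w [set r; Some j])
      \in [:: (1, 0, 0); (1, 0, 1); (0, 0, 1)]%N ->
  1 <= v [set i; j] - v [set j].
Proof.
move=> nji hij; have iNj : i \notin [set j] by rewrite inE eq_sym.
have jNi : j \notin [set i] by rewrite inE.
have mj : Some j \in rooted [set j] by rewrite mem_rooted inE.
have mi : Some i \in rooted [set i] by rewrite mem_rooted inE.
rewrite mcst_saving_marginal // lerBrDr -[1]/(1%:R) -natrD ler_nat.
(* Hanging [i] on [j] settles the triples (1,0,0) and (1,0,1); hanging [j] on [i] settles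
   (0,0,1). *)
have := mcst_cost_add w iNj mj; have := mcst_cost_add w jNi mi.
rewrite !mcst_cost1 (setUC [set j]) (setUC [set Some j]).
by move: hij; rewrite !inE => /or3P[]/eqP[-> -> ->].
Qed.

Lemma no_saving_null i : zero_one_weights w ->
    (forall j, j != i ->
       (w [set r; Some i], w [set Some i; Some j], w [set r; Some j])
         \notin [:: (1, 0, 0); (1, 0, 1); (0, 0, 1)]%N) ->
  null_player v i.
Proof.
move=> w01 no_j; apply: mcst_saving_null => S iS.
have neq_i j : j \in S -> j != i by apply: contraTneq => ->.
have w01r j : w [set r; Some j] = 0%N \/ w [set r; Some j] = 1%N.
  by have := w01 r (Some j) isT; rewrite !inE => /orP[]/eqP; [left|right].
have [wi | wi] := w01r i.
(* As (0,0,1) is excluded, w(i, j) = 0 forces w(r, j) = 0, so contracting [i] onto the root makes no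
   edge dearer. *)
- rewrite wi; have [T [sT cT <-]] := mcst_cost_witness w (i |: S).
  apply: leq_trans (mcst_cost_contract iS (rnode_rooted S) sT cT _).
    by rewrite leq_add2l.
  move=> [j|]; rewrite ?eqxx // mem_rooted => /neq_i nji _.
  have := no_j j nji; have nij : Some i != Some j by rewrite eq_sym.
  have := w01 _ _ nij; rewrite !inE wi => /orP[]/eqP->;
    by case: (w01r j) => ->; rewrite ?eqxx ?orbT.
(* As (1,0,0) and (1,0,1) are excluded, every edge from [i] to [rooted S] has weight 1, the largest
   possible, so contraction onto any neighbour is allowed. *)
- have w_i u : u \in rooted S -> w [set Some i; u] = 1%N.
    case: u => [j|_]; last by rewrite setUC.
    rewrite mem_rooted => /neq_i nji.
    have := no_j j nji; have nij : Some i != Some j by rewrite eq_sym.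
    have := w01 _ _ nij; rewrite !inE wi => /orP[]/eqP-> //.
    by case: (w01r j) => ->; rewrite ?eqxx ?orbT.
  have [p u pS uS nup|p pS] := mcst_cost_del (w := w) iS.
    rewrite w_i //; have := w01 p u; rewrite eq_sym => /(_ nup).
    by rewrite !inE => /orP[]/eqP->.
  by rewrite w_i // wi.
Qed.

End Savings.

Local Open Scope ring_scope.

Theorem corollary3p2 (R : realFieldType) (n : nat) (hn : (2 <= n)%N)
    (w : {set option 'I_n} -> nat) (hw : zero_one_weights w) (i : 'I_n) :
  let v : {set 'I_n} -> R := mcst_saving R w in
  [<-> shapley v i <> 0;
       ~ null_player v i;
       exists2 j : 'I_n, j != i &
         (w [set rnode n; Some i], w [set Some i; Some j], w [set rnode n; Some j])
           \in [:: (1, 0, 0); (1, 0, 1); (0, 0, 1)]%N;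
       1 / (n%:R * (n%:R - 1)) <= shapley v i].
Proof.
move=> v; tfae.
- by move=> phi_neq0 /null_player_shapley.
(* Statement (2) is a boolean existence over a finite type, so the contrapositive suffices without
   classical axioms. *)
- move=> not_null; apply/exists_inP; apply: contra_notT not_null.
  by move/exists_inPn; apply: no_saving_null.
- move=> [j nji hij]; apply: (shapley_ge hn nji).
    by move=> S; apply: mcst_saving_mono.
  exact: mcst_saving_pair.
(* The lower bound is positive because n is at least 2. *)
- move=> phi_ge phi0; move: phi_ge; rewrite phi0 leNgt divr_gt0 ?mulr_gt0 //.
    by rewrite ltr0n ltnW.
  by rewrite subr_gt0 ltr1n.
Qed.
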